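(* Let $(\mathcal{X},d)$ be a compact metric space such that there are finitely many subsets $\Omega_j\subset\mathcal{X}$, $1\le j\le n$, and a positive integer $m$ with - $\mathcal{X}=\bigcup_{j=1}^n\Omega_j$, and - there are bi-Lipschitz maps $\varphi_j:\Omega_j\to\varphi_j(\Omega_j)\subset\mathbb{R}^m$, $1\le j\le n$. Then for every real-valued $f\in C^\gamma(\mathcal{X})$, $\gamma\in(0,1)$, $$\overline{\dim}_M\left(\mathrm{Graph}(f)\right)\le(m+1)-\gamma.$$
   Context: A real-valued function $f$ on a metric space $(\mathcal{X},d)$ is in $C^\gamma(\mathcal{X})$, $\gamma\in(0,1)$, if there is $C>0$ with $|f(x)-f(y)|\le C\,d(x,y)^\gamma$ for all $x,y$. $\mathrm{Graph}(f)=\{(x,f(x)):x\in\mathcal{X}\}\subset\mathcal{X}\times\mathbb{R}$, with the product metric. Upper Minkowski dimension: for a totally bounded subset $E$ of a metric space, $\mathcal{N}_\varepsilon(E)$ is the smallest number of metric balls of radii $\le\varepsilon$ that cover $E$, and $\overline{\dim}_M(E):=\limsup_{\varepsilon\to0}\frac{\log\mathcal{N}_\varepsilon(E)}{\log(1/\varepsilon)}$. *)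

(* Defs.v *)
From HB Require Import structures.
From mathcomp Require Import all_boot all_order all_algebra.
From mathcomp Require Import all_classical all_reals all_analysis.

Set Implicit Arguments.
Unset Strict Implicit.
Unset Printing Implicit Defensive.

Import Order.TTheory GRing.Theory Num.Theory.
Import numFieldNormedType.Exports.

Local Open Scope classical_set_scope.
Local Open Scope ring_scope.

Definition holder (R : realType) (X : metricType R) (gamma : R) (f : X -> R) :=
  exists2 C : R, 0 < C &
    forall x y : X, `|f x - f y| <= C * mdist x y `^ gamma.

(* The norm of the library on 'rV[R]_m is the sup norm. *)
Definition euclidean_dist (R : realType) (m : nat) (u v : 'rV[R]_m) : R :=
  Num.sqrt (\sum_(i < m) (u ord0 i - v ord0 i) ^+ 2).

(* A map defined on A only is represented by a total function, whose values
   outside of A are irrelevant. *)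
Definition bilipschitz_on (R : realType) (X : metricType R) (m : nat)
    (A : set X) (phi : X -> 'rV[R]_m) :=
  exists2 L : R, 0 < L & forall x y : X, A x -> A y ->
    L^-1 * mdist x y <= euclidean_dist (phi x) (phi y) <= L * mdist x y.

(* In X * R, the balls of the library are the open balls of the product metric
   max (d x y) `|s - t|. *)
Definition fun_graph (R : realType) (X : metricType R) (f : X -> R) :
  set (X * R) := [set (x, f x) | x in [set: X]].

Definition covered_by_balls (R : realType) (T : pseudoMetricType R)
    (E : set T) (e : R) (k : nat) :=
  exists (c : 'I_k -> T) (r : 'I_k -> R),
    (forall i, 0 < r i <= e) /\ E `<=` \bigcup_i ball (c i) (r i).

(* This is +oo when E has no finite cover by such balls; otherwise the infimum
   is attained. *)
Definition covering_number (R : realType) (T : pseudoMetricType R)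
    (E : set T) (e : R) : \bar R :=
  ereal_inf [set k%:R%:E | k in [set k : nat | covered_by_balls E e k]].

Definition upper_minkowski_dim (R : realType) (T : pseudoMetricType R)
    (E : set T) : \bar R :=
  limf_esup (fun e : R =>
    (lne (covering_number E e) / (ln e^-1)%:E)%E) 0^'+.

(* Main.v *)
Require Import Defs.
From mathcomp Require Import all_boot all_order all_algebra.
From mathcomp Require Import all_classical all_reals all_analysis.
From mathcomp Require Import ring lra.

Set Implicit Arguments.
Unset Strict Implicit.
Unset Printing Implicit Defensive.

Import Order.TTheory GRing.Theory Num.Theory.
Import numFieldNormedType.Exports.

Local Open Scope classical_set_scope.
Local Open Scope ring_scope.

(** The exponent m + 1 - gamma comes from counting boxes of size e.

    Since X is compact, each chart image is bounded in R^m and meets O(e^-m)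
    cells of a grid whose mesh is proportional to e.  A chart is bi-Lipschitz,
    so the preimage of a cell has diameter at most e when the mesh is well
    chosen; hence a chart domain, and the finite union X of them, is covered by
    O(e^-m) balls of radius e ([chart_covering_growth],
    [covering_growth_bigcup]).

    Above one such ball the oscillation of f is O(e^gamma), so the part of the
    graph that lies there is covered by a vertical stack of O(e^(gamma - 1))
    balls of radius e.  Because gamma < 1 this number is at least of order 1,
    and the rounding up of the number of balls in a stack costs no more than a
    constant factor.  Altogether O(e^-(m + 1 - gamma)) balls suffice
    ([graph_covering_growth]).

    Such a bound with some constant K yields the dimension bound, as log K is
    negligible against log (1/e) ([upper_minkowski_dim_le]). *)

(** * Coverings indexed by a finite type *)

Lemma covered_by_fintype (R : realType) (T : pseudoMetricType R) (E : set T)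
    (e : R) (I : finType) (c : I -> T) :
  0 < e -> E `<=` \bigcup_i ball (c i) e -> covered_by_balls E e #|I|.
Proof.
move=> e_gt0 sub_E; exists (c \o enum_val), (fun=> e); split => [_|x Ex].
  by rewrite e_gt0 lexx.
by have [i _ xi] := sub_E x Ex; exists (enum_rank i); rewrite //= enum_rankK.
Qed.

(** A piece may miss A, and T may even be empty, so that there is no default
    centre to assign to every index.  Only the pieces that meet A receive a
    ball, centred at one of their points in A; this is why the number of balls
    is bounded by #|I| and not equal to it. *)
Lemma covered_by_small_pieces (R : realType) (T : pseudoMetricType R)
    (A : set T) (e : R) (I : finType) (P : I -> set T) :
  0 < e -> A `<=` \bigcup_i P i ->
  (forall i x y, A x -> A y -> P i x -> P i y -> ball x e y) ->
  exists2 k, (k <= #|I|)%N & covered_by_balls A e k.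
Proof.
move=> e_gt0 sub_A small.
pose meets i := `[< A `&` P i !=set0 >].
have /choice[c c_in] : forall i : {i | meets i},
    exists x, (A `&` P (val i)) x by move=> [i /= /asboolP].
exists #|{: {i | meets i}}|; first by rewrite card_sig max_card.
apply: (covered_by_fintype (c := c)) => // x Ax.
have [i _ Pix] := sub_A x Ax.
have meets_i : meets i by apply/asboolP; exists x.
exists (Sub i meets_i) => //.
by have [] := c_in (Sub i meets_i); rewrite /= => Ac Pc; apply: (small i).
Qed.

Lemma covered_setU (R : realType) (T : pseudoMetricType R) (A B : set T)
    (e : R) (k l : nat) :
  covered_by_balls A e k -> covered_by_balls B e l ->
  covered_by_balls (A `|` B) e (k + l).
Proof.
move=> [c [r [r_e sub_A]]] [d [s [s_e sub_B]]].
exists (fun i => match fintype.split i with inl j => c j | inr j => d j end).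
exists (fun i => match fintype.split i with inl j => r j | inr j => s j end).
split=> [i|x [/sub_A|/sub_B] [i _ xi]]; first by case: fintype.split.
  by exists (lshift l i) => //; rewrite (fintype.unsplitK (inl i)).
by exists (rshift k i) => //; rewrite (fintype.unsplitK (inr i)).
Qed.

(** * Grids on an interval *)

(** This one discretisation serves twice: for the coordinates of a chart, and
    for the heights of the graph above a ball.  The interval [-H, H] is shifted
    to [0, 2H] so that a natural number can index the cells. *)
Lemma grid_index (R : realType) (H d t : R) : 0 < d -> `|t| <= H ->
  exists i : 'I_(Num.truncn (2 * H / d)).+1,
    d * i%:R <= t + H < d * i%:R + d.
Proof.
move=> d_gt0; rewrite ler_norml => /andP[Ht tH].
have q_ge0 : 0 <= (t + H) / d by apply: divr_ge0; lra.
have q_le : (t + H) / d <= 2 * H / d by rewrite ler_pM2r ?invr_gt0//; lra.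
have lt_i : (Num.truncn ((t + H) / d) < (Num.truncn (2 * H / d)).+1)%N.
  by rewrite ltnS le_truncn.
exists (Ordinal lt_i) => /=.
have /andP[lo hi] := truncn_itv q_ge0.
rewrite -[X in _ < _ + X]mulr1 -mulrDr natr1 ![d * _]mulrC.
by rewrite -ler_pdivlMr// -ltr_pdivrMr// lo.
Qed.

Lemma grid_size (R : realType) (H d : R) : 0 <= H -> 0 < d ->
  (Num.truncn (2 * H / d)).+1%:R <= 2 * H / d + 1.
Proof.
by move=> H_ge0 d_gt0; rewrite -natr1 lerD2r truncn_le divr_ge0 ?mulr_ge0// ltW.
Qed.

(** * Polynomial growth of covering numbers *)

(** The covering numbers of A are O(e^-s).  Unlike the dimension, this notion
    keeps track of actual covers, which can be united and refined.  For
    e < 1 a bounded number of extra balls is dominated by any negative power of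
    e, which is what lets roundings be absorbed into K. *)
Definition covering_growth (R : realType) (T : pseudoMetricType R)
    (A : set T) (s : R) :=
  exists2 K : R, 0 < K & forall e : R, 0 < e < 1 ->
    exists2 k : nat, covered_by_balls A e k & k%:R <= K * e `^ (- s).

Lemma covering_growth0 (R : realType) (T : pseudoMetricType R) (s : R) :
  covering_growth (set0 : set T) s.
Proof.
exists 1 => // e _; exists 0%N; last by rewrite mul1r powR_ge0.
have no_index : forall P : Type, 'I_0 -> P by move=> P [].
by exists (no_index _), (no_index _); split=> [[]|].
Qed.

Lemma covering_growthU (R : realType) (T : pseudoMetricType R)
    (A B : set T) (s : R) :
  covering_growth A s -> covering_growth B s -> covering_growth (A `|` B) s.
Proof.
move=> [K K_gt0 cov_A] [L L_gt0 cov_B].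
exists (K + L) => [|e e01]; first exact: addr_gt0.
have [k cov_k k_le] := cov_A e e01; have [l cov_l l_le] := cov_B e e01.
exists (k + l)%N; first exact: covered_setU.
by rewrite natrD mulrDl lerD.
Qed.

Lemma covering_growth_bigcup (R : realType) (T : pseudoMetricType R)
    (I : finType) (A : I -> set T) (s : R) :
  (forall i, covering_growth (A i) s) -> covering_growth (\bigcup_i A i) s.
Proof.
move=> cov_A.
rewrite (_ : [set: I] = [set` enum I]); last first.
  by apply/seteqP; split=> i // _; rewrite /= mem_enum.
rewrite bigcup_seq; elim/big_ind: _ => //; first exact: covering_growth0.
by move=> ? ?; exact: covering_growthU.
Qed.

(** The constant is absorbed by an arbitrarily small loss eta in the exponent:
    K e^-s <= e^-(s + eta) as soon as e <= K^(-1/eta). *)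
Lemma upper_minkowski_dim_le (R : realType) (T : pseudoMetricType R)
    (A : set T) (s : R) :
  covering_growth A s -> (upper_minkowski_dim A <= s%:E)%E.
Proof.
move=> [K K_gt0 cov_A]; apply/lee_addgt0Pr => eta eta_gt0.
set e0 := Num.min 1 (K `^ (- eta^-1)).
have e0_gt0 : 0 < e0 by rewrite lt_min ltr01 powR_gt0.
rewrite /upper_minkowski_dim /limf_esup.
apply: (@le_trans _ _ (ereal_sup [set (lne (covering_number A e) /
    (ln e^-1)%:E)%E | e in [set e : R | 0 < e < e0]])).
  apply: ereal_inf_lbound; exists [set e : R | 0 < e < e0] => //.
  by apply: filterS2 (nbhs_right_gt 0) (nbhs_right_lt e0_gt0) => e e_gt0 e_lt;
    apply/andP.
apply: ge_ereal_sup => _ [e /= /andP[e_gt0 e_lt] <-].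
have /andP[e_lt1 e_ltK] : (e < 1) && (e < K `^ (- eta^-1)) by rewrite -lt_min.
have [k cov_k k_le] := cov_A e (introT andP (conj e_gt0 e_lt1)).
have cov_le : (covering_number A e <= (e `^ (- (s + eta)))%:E)%E.
  apply: (@le_trans _ _ k%:R%:E).
    by apply: ereal_inf_lbound; exists k.
  rewrite lee_fin (le_trans k_le)// opprD addrC powRD; last first.
    by rewrite (gt_eqF e_gt0) implybT.
  rewrite ler_pM2r ?powR_gt0// powRN -[K]invrK.
  rewrite lef_pV2 ?posrE ?invr_gt0 ?powR_gt0//.
  have -> : K^-1 = (K `^ (- eta^-1)) `^ eta.
    by rewrite -powRrM mulNr mulVf ?gt_eqF// powR_inv1 ?ltW.
  by apply: ge0_ler_powR; rewrite ?nnegrE ?powR_ge0// ltW.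
have ln_gt0 : 0 < ln e^-1 by rewrite ln_gt0 // invf_gt1.
rewrite inver gt_eqF// lee_pdivrMr//.
have cov_ge0 : (0 <= covering_number A e)%E.
  by apply: le_ereal_inf_tmp => _ [i _ <-]; rewrite lee_fin.
apply: (@le_trans _ _ (lne (e `^ (- (s + eta)))%:E)).
  by rewrite lee_lne// in_itv/= ?cov_ge0 ?lee_fin ?powR_ge0 leey.
rewrite lne_EFin ?powR_gt0// ln_powR lnV ?posrE// -EFinD -EFinM lee_fin.
by rewrite mulNr mulrN.
Qed.

(** * Bi-Lipschitz charts *)

(** Boundedness spreads from points to neighbourhoods by the triangle
    inequality, and compactness makes the bound uniform. *)
Lemma compact_bounded_dist (R : realType) (X : metricType R) (a : X) :
  compact [set: X] -> exists2 D : R, 0 < D & forall x, mdist a x <= D.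
Proof.
move=> /compact_near_coveringP/(_ R +oo (fun D x => mdist a x <= D) _) bounded.
have [|M [_ MD]] := bounded _.
  move=> x _.
  exists (ball x 1, [set D | mdist a x + 1 <= D]) => /=.
    split; first exact: nbhsx_ballx.
    exact: nbhs_pinfty_ge (num_real _).
  move=> [y D] [/=]; rewrite ballEmdist /= => xy aD.
  apply: le_trans aD; apply: le_trans (metric_triangle _ x _) _.
  by rewrite lerD2l ltW.
(* MD holds strictly beyond M, and the bound has to be positive. *)
exists (Num.max (M + 1) 1); first by rewrite lt_max ltr01 orbT.
move=> x; apply: (MD (Num.max (M + 1) 1)) => //.
by rewrite lt_max ltrDl ltr01.
Qed.

Lemma euclidean_dist_coord (R : realType) (m : nat) (u v : 'rV[R]_m) i :
  `|u ord0 i - v ord0 i| <= euclidean_dist u v.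
Proof.
rewrite -sqrtr_sqr ler_wsqrtr// (bigD1 i)//= lerDl sumr_ge0// => j _.
exact: sqr_ge0.
Qed.

(** The constant m instead of sqrt m avoids a square root; constants do not
    affect the exponent. *)
Lemma euclidean_dist_le (R : realType) (m : nat) (u v : 'rV[R]_m) (d : R) :
  0 <= d -> (forall i, `|u ord0 i - v ord0 i| <= d) ->
  euclidean_dist u v <= m%:R * d.
Proof.
move=> d_ge0 uv_le; rewrite -[leRHS]ger0_norm ?mulr_ge0// -sqrtr_sqr.
rewrite ler_wsqrtr// (@le_trans _ _ (\sum_(i < m) d ^+ 2))//.
  apply: ler_sum => i _.
  by rewrite -[leLHS]real_normK ?num_real// lerXn2r ?nnegrE.
rewrite sumr_const card_ord exprMn -[leLHS]mulr_natl ler_wpM2r ?sqr_ge0//.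
by rewrite -natrX ler_nat; case: (m) => // k; rewrite expnS leq_pmulr ?expn_gt0.
Qed.

(** As X is bounded, the upper Lipschitz bound makes the image of A bounded,
    which limits the number of grid cells that it meets; the lower one makes
    the preimages of the cells small. *)
Lemma chart_covering_growth (R : realType) (X : metricType R) (m : nat)
    (A : set X) (phi : X -> 'rV[R]_m) :
  compact [set: X] -> bilipschitz_on A phi -> covering_growth A m%:R.
Proof.
move=> compactX [L L_gt0 bilip].
have [->|/set0P[a Aa]] := eqVneq A set0; first exact: covering_growth0.
have [D D_gt0 aD] := compact_bounded_dist a compactX.
(* H bounds the coordinates of the image of A, seen from phi a. *)
pose H := L * D.
have H_gt0 : 0 < H by rewrite mulr_gt0.
(* Two points of A in the same cell of mesh e / p are at distance at most
   L * m * (e / p), which is < e because p counts m + 1 and not m. *)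
pose p := L * m.+1%:R.
have p_gt0 : 0 < p by rewrite mulr_gt0.
exists ((2 * H * p + 1) ^+ m) => [|e /andP[e_gt0 e_lt1]].
  by rewrite exprn_gt0// addr_gt0// !mulr_gt0.
pose d := e / p.
have d_gt0 : 0 < d by rewrite divr_gt0.
pose N := (Num.truncn (2 * H / d)).+1.
pose cell (q : {ffun 'I_m -> 'I_N}) := [set x : X | forall i : 'I_m,
  d * (q i)%:R <= (phi x ord0 i - phi a ord0 i) + H < d * (q i)%:R + d].
have cover_A : A `<=` \bigcup_q cell q.
  move=> x Ax.
  have : forall i, exists q : 'I_N,
      d * q%:R <= (phi x ord0 i - phi a ord0 i) + H < d * q%:R + d.
    move=> i; apply: grid_index => //.
    apply: le_trans (euclidean_dist_coord _ _ _) _.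
    have /andP[_ /le_trans->] // := bilip x a Ax Aa.
    by rewrite ler_pM2l// metric_sym.
  by move=> /choice[q qP]; exists [ffun i => q i] => // i; rewrite ffunE.
have small q x y : A x -> A y -> cell q x -> cell q y -> ball x e y.
  move=> Ax Ay qx qy; rewrite ballEmdist /=.
  have close i : `|phi x ord0 i - phi y ord0 i| <= d.
    have /andP[? ?] := qx i; have /andP[? ?] := qy i.
    by rewrite ler_norml; apply/andP; split; lra.
  have /andP[+ _] := bilip x y Ax Ay.
  rewrite mulrC ler_pdivrMr// => /le_lt_trans; apply.
  apply: (@le_lt_trans _ _ (m%:R * d * L)).
    by rewrite ler_pM2r// euclidean_dist_le// ltW.
  rewrite [ltRHS](_ : e = m.+1%:R * d * L); last first.
    by rewrite mulrAC [_ * L]mulrC -/p mulrC divfK ?gt_eqF.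
  by rewrite !ltr_pM2r// ltr_nat.
have [k k_le cov_k] := covered_by_small_pieces e_gt0 cover_A small.
exists k => //; rewrite powR_invn ?(ltW e_gt0)// -exprVn -exprMn.
move: k_le; rewrite card_ffun !card_ord -(ler_nat R) natrX => /le_trans; apply.
rewrite lerXn2r ?nnegrE//.
  by rewrite ltW// divr_gt0// addr_gt0// !mulr_gt0.
apply: le_trans (grid_size (ltW H_gt0) d_gt0) _.
rewrite [leRHS]mulrDl mul1r lerD//; last by rewrite invf_ge1// ltW.
by rewrite /d invf_div mulrA.
Qed.

(** * Graphs of Hoelder functions *)

(** Each ball of a cover of X carries a stack of balls of the same radius,
    which fills the window of half-height C e^gamma around the value of f at the
    centre. *)
Lemma graph_covering_growth (R : realType) (X : metricType R) (gamma s : R)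
    (f : X -> R) :
  0 < gamma < 1 -> holder gamma f -> covering_growth [set: X] s ->
  covering_growth (fun_graph f) (s + 1 - gamma).
Proof.
move=> /andP[gamma_gt0 gamma_lt1] [C C_gt0 f_C] [K K_gt0 cov_X].
exists (K * (2 * C + 1)) => [|e /andP[e_gt0 e_lt1]].
  by rewrite mulr_gt0// addr_gt0// mulr_gt0.
have [k [c [r [r_e sub_X]]] k_le] := cov_X e (introT andP (conj e_gt0 e_lt1)).
pose H := C * e `^ gamma.
have H_gt0 : 0 < H by rewrite mulr_gt0// powR_gt0.
pose N := (Num.truncn (2 * H / e)).+1.
exists #|{: 'I_k * 'I_N}|.
  pose center (q : 'I_k * 'I_N) := (c q.1, f (c q.1) - H + e * q.2%:R).
  apply: (covered_by_fintype (c := center)) => // _ [x _ <-].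
  have [i _] := sub_X x I; rewrite ballEmdist /= => xi.
  have ci_x : mdist (c i) x < e.
    by have /andP[_] := r_e i; apply: lt_le_trans.
  have f_ci : `|f x - f (c i)| <= H.
    rewrite distrC (le_trans (f_C _ _))// ler_pM2l//.
    by apply: ge0_ler_powR; rewrite ?nnegrE ?mdist_ge0 ?ltW.
  have [j /andP[lo hi]] := grid_index e_gt0 f_ci.
  exists (i, j) => //; split; first by rewrite ballEmdist.
  rewrite /= -ball_normE /= ltr_norml; apply/andP; split; lra.
rewrite card_prod !card_ord natrM.
have -> : - (s + 1 - gamma) = - s + (gamma - 1) by ring.
rewrite powRD; last by rewrite (gt_eqF e_gt0) implybT.
rewrite mulrACA ler_pM//.
apply: le_trans (grid_size (ltW H_gt0) e_gt0) _.
have -> : 2 * H / e = 2 * C * e `^ (gamma - 1).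
  rewrite powRB ?(gt_eqF e_gt0) ?implybT// powRr1 ?ltW// /H; ring.
(* The rounding term is 1 = e^0 <= e^(gamma - 1). *)
rewrite [leRHS]mulrDl mul1r lerD2l -[leLHS](powRr0 e).
apply: ger_powR; first by rewrite e_gt0 ltW.
by rewrite subr_le0 ltW.
Qed.

Theorem theorem5p1 (R : realType) (X : metricType R)
    (compactX : compact [set: X])
    (n m : nat) (m_gt0 : (0 < m)%N)
    (Omega : 'I_n -> set X) (coverX : [set: X] = \bigcup_j Omega j)
    (phi : 'I_n -> X -> 'rV[R]_m)
    (phi_bilip : forall j, bilipschitz_on (Omega j) (phi j))
    (gamma : R) (gamma01 : 0 < gamma < 1)
    (f : X -> R) (f_holder : holder gamma f) :
  (upper_minkowski_dim (fun_graph f) <= (m%:R + 1 - gamma)%:E)%E.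
Proof.
apply: upper_minkowski_dim_le; apply: graph_covering_growth => //.
rewrite coverX; apply: covering_growth_bigcup => j.
exact: chart_covering_growth.
Qed.
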